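(* The interpretability logic $\mathsf{ILM}$ is sound for conversely well-founded provability models (for the language $\mathcal L_\rhd$) with necessitation: if $\mathsf{ILM}\vdash A$ and $\mathcal P$ is such a model, then $\mathcal P,w\Vdash A$ for every world $w$ of $\mathcal P$.
   Context: Language $\mathcal L_\rhd$: formulas built from atomic propositions and $\bot$ using $\to$ and a binary modal operator $\rhd$; $\neg A:=A\to\bot$, other Boolean connectives defined classically, $\Box A:=\neg A\rhd\bot$, $\Diamond A:=\neg\Box\neg A$. A formula is purely modal if it is a Boolean combination of formulas of the form $B\rhd C$. $\mathsf{ILM}$ is the logic in $\mathcal L_\rhd$ whose only rule is modus ponens and whose axioms are: all theorems of $\mathsf{GL}$ (i.e. $\mathsf K$ plus $\Box A\to\Box\Box A$ and $\Box(\Box A\to A)\to\Box A$, formulated over $\mathcal L_\rhd$); $\Box(A\to B)\to A\rhd B$; $(A\rhd B\wedge B\rhd C)\to A\rhd C$; $(B\rhd A\wedge C\rhd A)\to(B\vee C)\rhd A$; $\Diamond A\rhd A$; $A\rhd B\to((\Box C\wedge A)\rhd(\Box C\wedge B))$; and $\Box X$ for $X$ any instance of the previous five schemes. A theory is a pair of a set of axioms and a set of inference rules (finitely many premises, one conclusion) over $\mathcal L_\rhd$; $\mathsf T\vdash A$ means derivability. A theory is classical if modus ponens is one of its rules and all classical tautologies are derivable. A provability pre-model is $\mathcal P=(W,\sqsubset,\{L_w\}_{w\in W^\sqsubset},V)$ with $W$ nonempty, $\sqsubset$ a binary relation on $W$, $V\subseteq W\times\mathrm{atoms}$, $W^\sqsubset=\{u:\exists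 v\,(v\sqsubset u)\}$, and a theory $L_w$ over $\mathcal L_\rhd$ for each $w\in W^\sqsubset$. Satisfaction: atoms via $V$, $\bot$ never holds, $\to$ classical, and $\mathcal P,w\Vdash A\rhd B$ iff for every $u$ with $w\sqsubset u$ and every formula $E$, $L_u\vdash B\to\Diamond E$ implies $L_u\vdash A\to\Diamond E$. With $\sqsubset^+$ the transitive closure, $\mathcal P,w\Vdash^+A$ iff there is $u\sqsubset w$ with $\mathcal P,v\Vdash A$ for all $v$ with $u\sqsubset^+v$. A provability model is a pre-model in which every $L_w$ is classical and modal completeness holds: for every $w\in W^\sqsubset$ and purely modal $A$, $\mathcal P,w\Vdash^+A$ implies $L_w\vdash A$. Necessitation: every $L_w$ has the rule ''from $A$ infer $\Box A$''. Conversely well-founded: no infinite chain $w_0\sqsubset w_1\sqsubset\cdots$. *)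

(* Defs.v *)
From Stdlib Require Import List Relations.
Import ListNotations.

Set Implicit Arguments.
Unset Strict Implicit.
Unset Printing Implicit Defensive.

Inductive form (atom : Type) : Type :=
| Atom (p : atom)
| Bot
| Imp (A B : form atom)
| Rhd (A B : form atom).

Arguments Bot {atom}.

Declare Scope form_scope.
Delimit Scope form_scope with form.
Bind Scope form_scope with form.

Definition Neg {atom} (A : form atom) : form atom := Imp A Bot.
Definition And {atom} (A B : form atom) : form atom := Neg (Imp A (Neg B)).
Definition Or {atom} (A B : form atom) : form atom := Imp (Neg A) B.
Definition Box {atom} (A : form atom) : form atom := Rhd (Neg A) Bot.
Definition Dia {atom} (A : form atom) : form atom := Neg (Box (Neg A)).

Notation "⊥" := Bot : form_scope.
Notation "¬ A" := (Neg A) (at level 35, right associativity) : form_scope.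
Notation "□ A" := (Box A) (at level 35, right associativity) : form_scope.
Notation "◇ A" := (Dia A) (at level 35, right associativity) : form_scope.
Notation "A ▷ B" := (Rhd A B) (at level 37, no associativity) : form_scope.
Notation "A ∧ B" := (And A B) (at level 40, left associativity) : form_scope.
Notation "A ∨ B" := (Or A B) (at level 41, left associativity) : form_scope.
Notation "A ⟶ B" := (Imp A B) (at level 55, right associativity) : form_scope.

Inductive purely_modal {atom} : form atom -> Prop :=
| pm_rhd B C : purely_modal (B ▷ C)
| pm_bot : purely_modal ⊥
| pm_imp A B : purely_modal A -> purely_modal B -> purely_modal (A ⟶ B).

(* [v] is only consulted on atoms and on formulas [B ▷ C], which count as
   propositional variables here. *)
Fixpoint bool_eval {atom} (v : form atom -> bool) (A : form atom) : bool :=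
  match A with
  | Bot => false
  | Imp B C => implb (bool_eval v B) (bool_eval v C)
  | Atom _ | Rhd _ _ => v A
  end.

Definition tautology {atom} (A : form atom) : Prop :=
  forall v : form atom -> bool, bool_eval v A = true.

(* A rule is given by its set of instances (premises, conclusion). *)
Definition rule (atom : Type) : Type := list (form atom) * form atom -> Prop.

Record theory (atom : Type) : Type := Theory {
  axioms : form atom -> Prop;
  rules : rule atom -> Prop
}.

Inductive derivable {atom} (T : theory atom) : form atom -> Prop :=
| der_axiom A : axioms T A -> derivable T A
| der_rule (r : rule atom) (prems : list (form atom)) (A : form atom) :
    rules T r -> r (prems, A) ->
    (forall B, In B prems -> derivable T B) ->
    derivable T A.

Inductive modus_ponens {atom} : rule atom :=
| mp_inst A B : modus_ponens ([A; (A ⟶ B)%form], B).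

Inductive necessitation {atom} : rule atom :=
| nec_inst A : necessitation ([A], (□ A)%form).

Definition classical {atom} (T : theory atom) : Prop :=
  rules T modus_ponens /\ (forall A, tautology A -> derivable T A).

Inductive GL_axiom {atom} : form atom -> Prop :=
| GL_taut A : tautology A -> GL_axiom A
| GL_K A B : GL_axiom (□ (A ⟶ B) ⟶ □ A ⟶ □ B)
| GL_4 A : GL_axiom (□ A ⟶ □ □ A)
| GL_Lob A : GL_axiom (□ (□ A ⟶ A) ⟶ □ A).

Definition GL (atom : Type) : theory atom :=
  Theory GL_axiom (fun r => r = modus_ponens \/ r = necessitation).

Inductive ILM_scheme {atom} : form atom -> Prop :=
| ILM_J1 A B : ILM_scheme (□ (A ⟶ B) ⟶ A ▷ B)
| ILM_J2 A B C : ILM_scheme ((A ▷ B) ∧ (B ▷ C) ⟶ A ▷ C)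
| ILM_J3 A B C : ILM_scheme ((B ▷ A) ∧ (C ▷ A) ⟶ (B ∨ C) ▷ A)
| ILM_J5 A : ILM_scheme (◇ A ▷ A)
| ILM_M A B C : ILM_scheme (A ▷ B ⟶ (□ C ∧ A) ▷ (□ C ∧ B)).

Inductive ILM_axiom {atom} : form atom -> Prop :=
| ILM_GL A : derivable (GL atom) A -> ILM_axiom A
| ILM_ax A : ILM_scheme A -> ILM_axiom A
| ILM_box_ax A : ILM_scheme A -> ILM_axiom (□ A).

Definition ILM (atom : Type) : theory atom :=
  Theory ILM_axiom (fun r => r = modus_ponens).

(* [thy] is total for convenience: only its values at worlds that have a
   predecessor are ever used or constrained. *)
Record premodel (atom : Type) : Type := Premodel {
  world : Type;
  world_nonempty : inhabited world;
  acc : world -> world -> Prop;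
  thy : world -> theory atom;
  val : world -> atom -> Prop
}.

Definition has_pred {atom} (P : premodel atom) (w : world P) : Prop :=
  exists u : world P, acc u w.

Fixpoint sat {atom} (P : premodel atom) (w : world P) (A : form atom) : Prop :=
  match A with
  | Atom p => val w p
  | Bot => False
  | Imp B C => sat w B -> sat w C
  | Rhd B C =>
      forall u : world P, acc w u ->
      forall E : form atom,
        derivable (thy u) (C ⟶ ◇ E) -> derivable (thy u) (B ⟶ ◇ E)
  end.

Definition sat_plus {atom} (P : premodel atom) (w : world P) (A : form atom)
    : Prop :=
  exists u : world P,
    acc u w /\ forall v : world P, clos_trans (world P) (@acc atom P) u v -> sat v A.

Definition modally_complete {atom} (P : premodel atom) : Prop :=
  forall w : world P, has_pred w ->
  forall A : form atom, purely_modal A -> sat_plus w A -> derivable (thy w) A.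

Definition provability_model {atom} (P : premodel atom) : Prop :=
  (forall w : world P, has_pred w -> classical (thy w)) /\ modally_complete P.

Definition with_necessitation {atom} (P : premodel atom) : Prop :=
  forall w : world P, has_pred w -> rules (thy w) necessitation.

Definition conversely_well_founded {atom} (P : premodel atom) : Prop :=
  ~ exists f : nat -> world P, forall n : nat, acc (f n) (f (S n)).

(* Main.v *)
(** In a model with necessitation, [w ⊩ □A] says exactly that every [L_u] with
    [w ⊏ u] proves [A]: take [E := ⊥] in the clause for [¬A ▷ ⊥] and use
    [L_u ⊢ ¬◇⊥].  Hence K and 4 hold at every world, Löb's axiom holds by
    induction along the converse of [⊏⁺], and modal completeness hands these
    purely modal validities over to each theory [L_u].  The interpretability
    axioms then reduce to modal reasoning inside [L_u]; for Montagna's axiom,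
    [□C ∧ B → ◇E] is rewritten as [B → ◇(C → E)], to which the hypothesis
    [A ▷ B] applies. *)

From Stdlib Require Import List Relations Wellfounded.
From Stdlib Require Import Classical ClassicalEpsilon.
Require Import Defs.
Import ListNotations.

Set Implicit Arguments.
Unset Strict Implicit.

Local Open Scope form_scope.

Ltac solve_tautology :=
  let v := fresh "v" in
  intro v; cbn;
  repeat match goal with
         | |- context [bool_eval v ?A] => destruct (bool_eval v A)
         | |- context [v ?A] => destruct (v A)
         end; reflexivity.

(** * Reasoning inside classical theories *)

Section ClassicalTheory.

Variables (atom : Type) (T : theory atom).
Hypothesis T_classical : classical T.

Lemma derivable_mp A B : derivable T (A ⟶ B) -> derivable T A -> derivable T B.
Proof.
  intros hAB hA.
  apply (@der_rule _ T modus_ponens [A; A ⟶ B]).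
  - apply T_classical.
  - constructor.
  - intros C [<- | [<- | []]]; assumption.
Qed.

Lemma derivable_taut1 A B :
  derivable T A -> tautology (A ⟶ B) -> derivable T B.
Proof. intros hA ht; apply (derivable_mp (A := A)); [apply T_classical |]; auto. Qed.

Lemma derivable_taut2 A B C :
  derivable T A -> derivable T B -> tautology (A ⟶ B ⟶ C) -> derivable T C.
Proof.
  intros hA hB ht; apply (derivable_mp (A := B)); [| exact hB].
  exact (derivable_taut1 hA ht).
Qed.

Lemma derivable_taut3 A B C D :
  derivable T A -> derivable T B -> derivable T C ->
  tautology (A ⟶ B ⟶ C ⟶ D) -> derivable T D.
Proof.
  intros hA hB hC ht; apply (derivable_mp (A := C)); [| exact hC].
  exact (derivable_taut2 hA hB ht).
Qed.

Hypothesis T_nec : rules T necessitation.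

Lemma derivable_nec A : derivable T A -> derivable T (□ A).
Proof.
  intros hA; apply (@der_rule _ T necessitation [A]); auto.
  - constructor.
  - intros C [<- | []]; assumption.
Qed.

(** The left side is the clause of [sat] for [¬ A ▷ ⊥] at a single successor whose theory is [T]. *)
Lemma derivable_box_iff A :
  (forall E, derivable T (⊥ ⟶ ◇ E) -> derivable T (¬ A ⟶ ◇ E)) <->
  derivable T A.
Proof.
  split.
  - intros h.
    assert (hbot : derivable T (□ ¬ ⊥)).
    { apply derivable_nec, T_classical; solve_tautology. }
    assert (hA : derivable T (¬ A ⟶ ◇ ⊥)).
    { apply h, T_classical; solve_tautology. }
    apply (derivable_taut2 hbot hA); solve_tautology.
  - intros hA E _; apply (derivable_taut1 hA); solve_tautology.
Qed.

Hypothesis T_K : forall A B, derivable T (□ (A ⟶ B) ⟶ □ A ⟶ □ B).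

Lemma derivable_box_mono A B :
  derivable T (A ⟶ B) -> derivable T (□ A ⟶ □ B).
Proof. intros h; exact (derivable_mp (T_K A B) (derivable_nec h)). Qed.

(** By contraposition: [¬ (C ⟶ E)] yields both [C] and [¬ E], so boxing it yields [□ C] and
    [□ ¬ E]. *)
Lemma derivable_dia_imp C E :
  derivable T ((□ C ⟶ ◇ E) ⟶ ◇ (C ⟶ E)).
Proof.
  assert (h1 : derivable T (□ ¬ (C ⟶ E) ⟶ □ C)).
  { apply derivable_box_mono, T_classical; solve_tautology. }
  assert (h2 : derivable T (□ ¬ (C ⟶ E) ⟶ □ ¬ E)).
  { apply derivable_box_mono, T_classical; solve_tautology. }
  apply (derivable_taut2 h1 h2); solve_tautology.
Qed.

(** Since [C] and [¬ E] refute [C ⟶ E], under [□ C] the formula [□ ¬ E] gives [□ ¬ (C ⟶ E)];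
    contrapose. *)
Lemma derivable_dia_imp_box C E :
  derivable T (◇ (C ⟶ E) ⟶ □ C ⟶ ◇ E).
Proof.
  assert (h : derivable T (□ C ⟶ □ (¬ E ⟶ ¬ (C ⟶ E)))).
  { apply derivable_box_mono, T_classical; solve_tautology. }
  apply (derivable_taut2 h (T_K (¬ E) (¬ (C ⟶ E)))); solve_tautology.
Qed.

(** Contraposing [A ⟶ ◇ E] and boxing gives [□ □ ¬ E ⟶ □ ¬ A]; axiom 4 for [¬ E] removes one box. *)
Lemma derivable_dia_bind A E :
  derivable T (□ ¬ E ⟶ □ □ ¬ E) ->
  derivable T (A ⟶ ◇ E) -> derivable T (◇ A ⟶ ◇ E).
Proof.
  intros h4 hA.
  assert (h : derivable T (□ □ ¬ E ⟶ □ ¬ A)).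
  { apply derivable_box_mono, (derivable_taut1 hA); solve_tautology. }
  apply (derivable_taut2 h4 h); solve_tautology.
Qed.

End ClassicalTheory.

(** * Converse well-foundedness *)

(** Dependent choice: an inaccessible point has an inaccessible [R]-successor, so iterating a choice
    of successors gives an infinite chain. *)
Lemma no_chain_well_founded (W : Type) (R : W -> W -> Prop) :
  (~ exists f : nat -> W, forall n, R (f n) (f (S n))) ->
  well_founded (fun u v => R v u).
Proof.
  intros hR w; apply NNPP; intros hw; apply hR.
  pose (bad := {u | ~ Acc (fun u v => R v u) u}).
  assert (step : forall u : bad, exists v : bad, R (proj1_sig u) (proj1_sig v)).
  { intros [u hu]; cbn; apply NNPP; intros hno; apply hu; constructor.
    intros v huv; apply NNPP; intros hv; apply hno.
    exists (exist _ v hv); exact huv. }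
  pose (next u := proj1_sig (constructive_indefinite_description _ (step u))).
  exists (fun n => proj1_sig (Nat.iter n next (exist _ w hw))); intros n; cbn.
  exact (proj2_sig (constructive_indefinite_description _ (step _))).
Qed.

Lemma no_chain_trans_ind (W : Type) (R : W -> W -> Prop) (Q : W -> Prop) :
  (~ exists f : nat -> W, forall n, R (f n) (f (S n))) ->
  (forall w, (forall v, clos_trans W R w v -> Q v) -> Q w) ->
  forall w, Q w.
Proof.
  intros hR hQ w.
  pose proof (wf_clos_trans _ _ (no_chain_well_founded hR)) as wf.
  induction w as [w IH] using (well_founded_ind wf).
  apply hQ; intros v hv; apply IH.
  (* The transitive closure of the converse is the converse of the transitive closure. *)
  clear IH; induction hv; eauto using clos_trans.
Qed.

(** * Soundness *)

Section Soundness.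

Variables (atom : Type) (P : premodel atom).
Implicit Types (w u : world P) (A B C E : form atom).

Lemma sat_and w A B : sat w (A ∧ B) <-> sat w A /\ sat w B.
Proof. cbn; tauto. Qed.

Lemma sat_tautology w A : tautology A -> sat w A.
Proof.
  intros hA.
  (* The valuation reads off truth at [w]; by induction [bool_eval v] then agrees with [sat w] on
     every formula. *)
  pose (v := fun B => if excluded_middle_informative (sat w B) then true else false).
  assert (hv : forall B, bool_eval v B = true <-> sat w B).
  { assert (hv0 : forall B, v B = true <-> sat w B).
    { intros B; unfold v; destruct excluded_middle_informative;
        split; easy. }
    induction B as [p | | B IHB C IHC | B IHB C IHC].
    - apply hv0.
    - split; easy.
    - cbn; rewrite <- IHB, <- IHC.
      destruct (bool_eval v B), (bool_eval v C); cbn; intuition discriminate.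
    - apply hv0. }
  apply hv, hA.
Qed.

Hypotheses (hmodel : provability_model P) (hnec : with_necessitation P).

Lemma thy_classical u : has_pred u -> classical (thy u).
Proof. apply hmodel. Qed.

Lemma acc_has_pred w u : acc w u -> has_pred u.
Proof. now exists w. Qed.

Lemma sat_box w A :
  sat w (□ A) <-> forall u, acc w u -> derivable (thy u) A.
Proof.
  split; intros h u hu; pose proof (acc_has_pred hu) as hp;
    apply derivable_box_iff; auto using thy_classical.
Qed.

(** Truth at all worlds gives [sat_plus], with any predecessor of [u] as witness, and modal
    completeness applies. *)
Lemma valid_purely_modal_derivable A :
  purely_modal A -> (forall w, sat w A) ->
  forall u, has_pred u -> derivable (thy u) A.
Proof.
  intros hA hsat u hu; apply hmodel; auto.
  destruct hu as [w hw]; exists w; auto.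
Qed.

(** * Axioms K and 4, at worlds and inside their theories *)

Lemma sat_K w A B : sat w (□ (A ⟶ B) ⟶ □ A ⟶ □ B).
Proof.
  change (sat w (□ (A ⟶ B)) -> sat w (□ A) -> sat w (□ B)).
  rewrite !sat_box; intros hAB hA u hu.
  exact (derivable_mp (thy_classical (acc_has_pred hu)) (hAB u hu) (hA u hu)).
Qed.

Lemma sat_4 w A : sat w (□ A ⟶ □ □ A).
Proof.
  change (sat w (□ A) -> sat w (□ □ A)).
  rewrite !sat_box; intros hA u hu.
  exact (derivable_nec (hnec (acc_has_pred hu)) (hA u hu)).
Qed.

Lemma derivable_K u A B :
  has_pred u -> derivable (thy u) (□ (A ⟶ B) ⟶ □ A ⟶ □ B).
Proof.
  apply valid_purely_modal_derivable.
  - repeat constructor.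
  - intros w; apply sat_K.
Qed.

Lemma derivable_4 u A : has_pred u -> derivable (thy u) (□ A ⟶ □ □ A).
Proof.
  apply valid_purely_modal_derivable.
  - repeat constructor.
  - intros w; apply sat_4.
Qed.

(** * The interpretability axioms *)

Lemma purely_modal_ILM_scheme A : ILM_scheme A -> purely_modal A.
Proof. intros []; repeat constructor. Qed.

Lemma sat_ILM_scheme w A : ILM_scheme A -> sat w A.
Proof.
  intros [B C | B C D | B C D | B | B C D].
  - change (sat w (□ (B ⟶ C)) -> sat w (B ▷ C)); rewrite sat_box.
    intros hBC u hu E hC.
    apply (derivable_taut2 (thy_classical (acc_has_pred hu)) (hBC u hu) hC).
    solve_tautology.
  - change (sat w ((B ▷ C) ∧ (C ▷ D)) -> sat w (B ▷ D)); rewrite sat_and.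
    intros [hBC hCD] u hu E hD.
    exact (hBC u hu E (hCD u hu E hD)).
  - change (sat w ((C ▷ B) ∧ (D ▷ B)) -> sat w ((C ∨ D) ▷ B)); rewrite sat_and.
    intros [hC hD] u hu E hB.
    apply (derivable_taut2 (thy_classical (acc_has_pred hu))
             (hC u hu E hB) (hD u hu E hB)).
    solve_tautology.
  - intros u hu E hB; pose proof (acc_has_pred hu) as hp.
    apply derivable_dia_bind;
      auto using thy_classical, derivable_K, derivable_4.
  - intros hBC u hu E hE; pose proof (acc_has_pred hu) as hp.
    pose proof (thy_classical hp) as hcl.
    assert (hC : derivable (thy u) (C ⟶ ◇ (D ⟶ E))).
    { apply (derivable_taut2 hcl hE
               (derivable_dia_imp hcl (hnec hp)
                  (fun A B => derivable_K A B hp) D E)).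
      solve_tautology. }
    (* [B ▷ C], used with [D ⟶ E] in place of [E], gives [B ⟶ ◇ (D ⟶ E)]; the diamond is then
       unfolded back to [□ D ⟶ ◇ E]. *)
    apply (derivable_taut2 hcl (hBC u hu _ hC)
             (derivable_dia_imp_box hcl (hnec hp)
                (fun A B => derivable_K A B hp) D E)).
    solve_tautology.
Qed.

(** * Löb's axiom and induction on derivations *)

Hypothesis hcwf : conversely_well_founded P.

Lemma sat_Lob w A : sat w (□ (□ A ⟶ A) ⟶ □ A).
Proof.
  revert w; apply (no_chain_trans_ind hcwf); intros w IH.
  change (sat w (□ (□ A ⟶ A)) -> sat w (□ A)).
  rewrite !sat_box; intros h u hu.
  pose proof (acc_has_pred hu) as hp.
  pose proof (thy_classical hp) as hcl.
  (* The induction hypothesis covers all worlds above [w] in the transitive closure, which is what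
     [sat_plus u] asks with witness [w]. *)
  assert (hLob : derivable (thy u) (□ (□ A ⟶ A) ⟶ □ A)).
  { apply hmodel; [exact hp | repeat constructor | now exists w]. }
  (* The theory proves [□ A ⟶ A], hence its box by necessitation, hence [□ A] by Löb's axiom, hence
     [A]. *)
  apply (derivable_taut3 hcl hLob (h u hu)
           (derivable_nec (hnec hp) (h u hu))).
  solve_tautology.
Qed.

(** Both claims are proved together: the necessitation case needs derivability in the theories, and
    this does not follow from validity by modal completeness when [A] is not purely modal. *)
Lemma GL_sound A :
  derivable (GL atom) A ->
  (forall w, sat w A) /\ (forall u, has_pred u -> derivable (thy u) A).
Proof.
  induction 1 as [A hA | r prems A hr hinst _ IH].
  - destruct hA as [A hA | A B | A | A].
    + split; [intros w; apply sat_tautology, hA |].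
      intros u hu; apply (thy_classical hu), hA.
    + split; [intros w; apply sat_K | intros u; apply derivable_K].
    + split; [intros w; apply sat_4 | intros u; apply derivable_4].
    + split; [intros w; apply sat_Lob |].
      apply valid_purely_modal_derivable; [repeat constructor |].
      intros w; apply sat_Lob.
  - destruct hr as [-> | ->].
    + inversion hinst; subst.
      destruct (IH A0) as [hA hdA]; [now left |].
      destruct (IH (A0 ⟶ A)) as [hAB hdAB]; [now right; left |].
      split; [intros w; exact (hAB w (hA w)) |].
      intros u hu; exact (derivable_mp (thy_classical hu) (hdAB u hu) (hdA u hu)).
    + inversion hinst; subst.
      destruct (IH A0) as [_ hdA]; [now left |].
      split.
      * intros w; apply sat_box; intros u hu; exact (hdA u (acc_has_pred hu)).
      * intros u hu; exact (derivable_nec (hnec hu) (hdA u hu)).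
Qed.

Lemma ILM_sound A : derivable (ILM atom) A -> forall w, sat w A.
Proof.
  induction 1 as [A hA | r prems A hr hinst _ IH]; intros w.
  - destruct hA as [A hA | A hA | A hA].
    + now apply GL_sound.
    + now apply sat_ILM_scheme.
    (* The scheme instance under the box is purely modal and valid, so each successor's theory
       proves it. *)
    + apply sat_box; intros u hu.
      apply valid_purely_modal_derivable.
      * now apply purely_modal_ILM_scheme.
      * intros v; now apply sat_ILM_scheme.
      * exact (acc_has_pred hu).
  - cbn in hr; subst r; inversion hinst; subst.
    apply (IH (A0 ⟶ A)); [now right; left |].
    apply IH; now left.
Qed.

End Soundness.

Theorem theorem5p5 (atom : Type) (P : premodel atom)
  (hmodel : provability_model P)
  (hnec : with_necessitation P)
  (hcwf : conversely_well_founded P)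
  (A : form atom) (hA : derivable (ILM atom) A) (w : world P) :
  sat w A.
Proof. exact (ILM_sound hmodel hnec hcwf hA w). Qed.
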